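(* There are precisely fifteen nonzero $\mathcal{G}_{\mathcal{S}}$-invariant polynomial functions $Q$ on $\operatorname{PG}(7,2)$ of (reduced) degree $<8$. They are in bijection with the proper subsets $\alpha$ of $\{1,2,3,4\}$, the zero set $\psi_Q=\{x: Q(x)=0\}$ (a set of points of $\operatorname{PG}(7,2)$) of the polynomial corresponding to $\alpha$ being $$\psi_Q=\mathcal{O}_5\cup\bigcup_{i\in\alpha}\mathcal{O}_i.$$ These fifteen $\mathcal{G}_{\mathcal{S}}$-invariant polynomials consist of one quadratic (degree 2), six quartic (degree 4) and eight sextic (degree 6) polynomials.
   Context: Everything is over $\operatorname{GF}(2)$. Let $V_2$ be a 2-dimensional vector space over $\operatorname{GF}(2)$ with nonzero vectors $u_0,u_1,u_2$ (so $u_2=u_0+u_1$), and $V_8=V_2\otimes V_2\otimes V_2$. Points of $\operatorname{PG}(7,2)=\mathbb{P}V_8$ are identified with nonzero vectors of $V_8$. Put $E_{ijk}=u_i\otimes u_j\otimes u_k$ for $i,j,k\in\{0,1,2\}$. The Segre variety is the 27-point set $\mathcal{S}=\mathcal{S}_{1,1,1}(2)=\{E_{ijk}\}$; $\mathcal{G}_{\mathcal{S}}$ is its stabilizer in $\operatorname{GL}(V_8)$, equal to $\mathcal{N}\rtimes\operatorname{Sym}(3)$ where $\mathcal{N}=\operatorname{GL}(V_2)^3$ acts by maps $a_1\otimes a_2\otimes a_3$ and $\operatorname{Sym}(3)$ permutes the tensor factors. Polynomial functions are taken with zero constant term ($Q(0)=0$) and in reduced form: in coordinates $x_1,\dots,x_8$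 with respect to a basis of $V_8$, $Q$ is a sum of squarefree monomials $x_{i_1}\cdots x_{i_k}$, $k\ge1$, $1\le i_1<\cdots<i_k\le 8$; the (reduced) degree of $Q$ is the degree of this unique reduced form and does not depend on the basis. $Q$ is $\mathcal{G}_{\mathcal{S}}$-invariant if $Q(Ax)=Q(x)$ for all $A\in\mathcal{G}_{\mathcal{S}}$, $x\in V_8$. The point sets $\mathcal{O}_i$ (the $\mathcal{G}_{\mathcal{S}}$-orbits of points) are: $\mathcal{O}_5=\mathcal{S}$; $\mathcal{O}_2$ is the set of points outside $\mathcal{S}$ lying in one of the nine 3-flats spanned by the 9-point subsets of $\mathcal{S}$ obtained by fixing one of the three indices of $E_{ijk}$; $\mathcal{O}_4$ is the set of points outside $\mathcal{S}$ lying on some distinguished tangent $L(p)$, $p\in\mathcal{S}$, where $L(p)=\{p,p',p''\}$ and $p',p''$ are the two points of the 3-flat spanned by the three generators through $p$ that lie in none of the three planes spanned by two of these generators (generators are the lines in $\mathcal{S}$ obtained by fixing two indices of $E_{ijk}$ and letting the third vary); $\mathcal{O}_3$ is the set of points $E_{ijk}+E_{i'j'k'}$ with $i\ne i'$, $j\ne j'$, $k\ne k'$; and $\mathcal{O}_1$ is the set of all remaining points. Their sizes are $|\mathcal{O}_1|=12$, $|\mathcal{O}_2|=54$, $|\mathcal{O}_3|=108$, $|\mathcal{O}_4|=54$, $|\mathcal{O}_5|=27$. *)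

(* Defs.v *)
From HB Require Import structures.
From mathcomp Require Import all_boot all_order all_fingroup all_algebra.
From mathcomp Require Import mxtens.
From mathcomp.multinomials Require Import mpoly.

Set Implicit Arguments.
Unset Strict Implicit.
Unset Printing Implicit Defensive.

Import GRing.Theory.
Local Open Scope ring_scope.

Definition V2 : Type := 'cV['F_2]_2.

(* V8 is the space of columns of length 2 * 2 * 2, so that [a *t b *t c] is the
   pure tensor of three vectors of V2.  Points of PG(7,2) are the nonzero
   elements of V8. *)
Notation V8 := 'cV['F_2]_8.

Definition u (i : 'I_3) : V2 :=
  if i == 0%N :> nat then delta_mx 0 0
  else if i == 1%N :> nat then delta_mx 1 0
  else delta_mx 0 0 + delta_mx 1 0.

(* A triple (i, j, k) of indices in {0, 1, 2} is a function 'I_3 -> 'I_3, so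
   that the three tensor positions can be treated uniformly. *)
Notation triple := {ffun 'I_3 -> 'I_3}.

Definition E (t : triple) : V8 :=
  u (t (inord 0)) *t u (t (inord 1)) *t u (t (inord 2)).

Definition Segre : {set V8} := [set E t | t : triple].

Definition GS : {set 'M['F_2]_8} :=
  [set A | (A \in unitmx) && ([set A *m x | x in Segre] == Segre)].

(* The projective points of the flat spanned by a set of points. *)
Definition flat (X : {set V8}) : {set V8} :=
  [set x | (x != 0) && (x \in <<enum X>>%VS)].

Definition slice (m a : 'I_3) : {set V8} := [set E t | t : triple & t m == a].

(* The generator through E t along which the m-th index varies. *)
Definition generator (t : triple) (m : 'I_3) : {set V8} :=
  [set E s | s : triple & [forall n, (n != m) ==> (s n == t n)]].

(* Since there are three generators through E t, the planes spanned by two of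
   them correspond to the generator that is left out. *)
Definition tangent (t : triple) : {set V8} :=
  E t |: (flat (\bigcup_m generator t m)
            :\: \bigcup_m flat (\bigcup_(n | n != m) generator t n)).

Definition O5 : {set V8} := Segre.

Definition O2 : {set V8} := (\bigcup_m (\bigcup_a flat (slice m a))) :\: Segre.

Definition O4 : {set V8} := (\bigcup_t tangent t) :\: Segre.

Definition O3 : {set V8} :=
  [set E st.1 + E st.2 | st : triple * triple & [forall m, st.1 m != st.2 m]].

Definition O1 : {set V8} := [set x | x != 0] :\: (O2 :|: O3 :|: O4 :|: O5).

(* The index set {1, 2, 3, 4} is shifted to 'I_4: [O_ i] is O_{i+1}. *)
Definition O_ (i : 'I_4) : {set V8} := nth set0 [:: O1; O2; O3; O4] i.

(* Reduced form with zero constant term: every monomial is squarefree and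
   different from 1.  Such polynomials correspond one-to-one to the functions
   V8 -> GF(2) vanishing at 0. *)
Definition reduced (Q : {mpoly 'F_2[8]}) : Prop :=
  forall m, m \in msupp Q -> m != 0%MM /\ forall i, (m i <= 1)%N.

Definition peval (Q : {mpoly 'F_2[8]}) (x : V8) : 'F_2 :=
  Q.@[fun i => x i 0].

(* [msize] is one more than the total degree for a nonzero polynomial. *)
Definition degree (Q : {mpoly 'F_2[8]}) : nat := (msize Q).-1.

Definition GS_invariant (Q : {mpoly 'F_2[8]}) : Prop :=
  forall A x, A \in GS -> peval Q (A *m x) = peval Q x.

Definition zero_set (Q : {mpoly 'F_2[8]}) : {set V8} :=
  [set x | (x != 0) && (peval Q x == 0)].

(* Main.v *)
Require Import Defs.
From mathcomp Require Import all_boot all_order all_fingroup all_algebra.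
From mathcomp Require Import mxtens.
From mathcomp.multinomials Require Import mpoly.
Set Implicit Arguments.
Unset Strict Implicit.
Unset Printing Implicit Defensive.
Import GRing.Theory.
Local Open Scope ring_scope.

(** The five sets O1, ..., O5 partition the points, and each is a single orbit
    of GS.  Hence an invariant function is given by its values at the zero
    vector and on the five sets.  Reduced polynomials in n variables correspond
    to functions on the subsets of an n-element set (the
    supports of the vectors): by Moebius inversion over GF(2), which is its own
    inverse (mobiusK), the coefficient of the monomial with support S is the
    sum of the values over the subsets of S (mcoeff_sqfree_poly, anf_meval).
    The top coefficient is thus the sum of all values.  As |O5| = 27 is odd and
    |O1|, ..., |O4| = 12, 54, 108, 54 are even, a nonzero invariant polynomial without
    constant term has degree < 8 exactly when it vanishes on O5, and it is then
    determined by the proper subset of indices of the O_i on which it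
    vanishes (invariant_poly_classification).

    That the O_i are invariant under all of GS is seen by counting (reps,
    orbit_index_GS): the number of Segre points p with x + p on the Segre
    variety is 6 on O2 and on O5, 2 on O3, 27 at the zero vector and 0 on O1 and
    O4; these last two are told apart by the number of Segre points p with x + p
    in O3, which is 9 on O1 and 12 on O4.  That each O_i lies in one orbit is
    seen by exhibiting four involutions of GS and exploring from a
    representative (GS_invariant_orbit_rep).

    The geometry of the 256 vectors and the fifteen degrees are settled by
    evaluation.  For this, vectors are encoded by lists of booleans (code), and
    every set in the definitions is shown to be the set of vectors encoded by a
    computed list (mem_Segre, mem_O1, ..., mem_O4). *)

(** * Moebius inversion and squarefree polynomials over GF(2) *)

Lemma F2_boolE (c : 'F_2) : c = (c != 0)%:R.
Proof. by case: c => [[|[|]]] // ?; apply/val_inj. Qed.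

Lemma F2_mulr2n (c : 'F_2) : c *+ 2 = 0.
Proof. by rewrite -mulr_natr (F2_boolE c); case: (c != 0); apply/val_inj. Qed.

Definition mobius n (f : {set 'I_n} -> 'F_2) (S : {set 'I_n}) : 'F_2 :=
  \sum_(T : {set 'I_n} | T \subset S) f T.

Lemma card_set_interval n (T U : {set 'I_n}) :
  T \subset U -> #|[set S : {set 'I_n} | T \subset S & S \subset U]| = (2 ^ #|U :\: T|)%N.
Proof.
move=> sTU; rewrite -card_powerset.
have -> : [set S : {set 'I_n} | T \subset S & S \subset U]
   = [set T :|: R | R in powerset (U :\: T)].
  apply/setP=> S; rewrite inE; apply/andP/imsetP.
    case=> sTS sSU; exists (S :\: T); first by rewrite inE setSD.
    by rewrite setUC setDE setUIl [~: T :|: T]setUC setUCr setIT (setUidPl sTS).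
  case=> R; rewrite inE subsetD => /andP[sRU _] ->.
  by rewrite subsetUl subUset sTU.
apply: card_in_imset => R1 R2; rewrite !inE !subsetD.
move=> /andP[_ d1] /andP[_ d2] e.
have D (R : {set _}) : [disjoint R & T] -> R = (T :|: R) :\: T.
  by move=> d; rewrite setDUl setDv set0U; apply/esym/setDidPl.
by rewrite (D _ d1) (D _ d2) e.
Qed.

(** After exchanging the sums, f T is counted once for each S between T and U,
    that is 2 ^ #|U :\: T| times, an even number unless T = U. *)
Lemma mobiusK n (f : {set 'I_n} -> 'F_2) : mobius (mobius f) =1 f.
Proof.
move=> U; rewrite /mobius /= (exchange_big_dep (fun T : {set _} => T \subset U)) /=; last first.
  by move=> S T sSU sTS; apply: subset_trans sTS sSU.
rewrite (bigD1 U) //= [X in _ + X]big1 ?addr0.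
  rewrite (eq_bigl (pred1 U)) ?big_pred1_eq // => S.
  by rewrite /= eqEsubset.
move=> T /andP[sTU neTU].
rewrite sumr_const.
have -> : #|[pred S : {set 'I_n} | (S \subset U) && (T \subset S)]|
  = #|[set S : {set 'I_n} | T \subset S & S \subset U]|.
  by apply: eq_card => S; rewrite !inE andbC.
rewrite card_set_interval //.
have : (0 < #|U :\: T|)%N.
  rewrite card_gt0; apply: contra neTU; rewrite setD_eq0 => sUT.
  by rewrite eqEsubset sTU.
by case: #|_| => // k _; rewrite expnS mulrnA F2_mulr2n mul0rn.
Qed.

Lemma mobius_set0 n (f : {set 'I_n} -> 'F_2) : mobius f set0 = f set0.
Proof.
by rewrite /mobius (eq_bigl (pred1 set0)) ?big_pred1_eq // => T; rewrite subset0.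
Qed.

Definition sqfree_mnm n (S : {set 'I_n}) : 'X_{1..n} := [multinom (i \in S : nat) | i < n].

Lemma sqfree_mnm_inj n : injective (@sqfree_mnm n).
Proof.
move=> S T /mnmP e; apply/setP=> i; move: (e i); rewrite !mnmE.
by do 2!case: (_ \in _).
Qed.

Lemma sqfree_mnmP n (m : 'X_{1..n}) :
  (forall i, (m i <= 1)%N) -> m = sqfree_mnm [set i | m i == 1%N].
Proof.
by move=> le1; apply/mnmP=> i; rewrite mnmE inE; case: (m i) (le1 i) => [|[]].
Qed.

Lemma mdeg_sqfree n (S : {set 'I_n}) : mdeg (sqfree_mnm S) = #|S|.
Proof.
rewrite mdegE -sum1_card [RHS]big_mkcond /=.
by apply: eq_bigr => i _; rewrite mnmE; case: (_ \in _).
Qed.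

Lemma sqfree_mnm0 n : sqfree_mnm set0 = 0%MM :> 'X_{1..n}.
Proof. by apply/mnmP => i; rewrite mnmE mnm0E inE. Qed.

Definition sqfree_poly n (c : {set 'I_n} -> 'F_2) : {mpoly 'F_2[n]} :=
  \sum_S c S *: 'X_[sqfree_mnm S].

Lemma mcoeff_sqfree_poly n (c : {set 'I_n} -> 'F_2) S :
  (sqfree_poly c)@_(sqfree_mnm S) = c S.
Proof.
rewrite raddf_sum /= (bigD1 S) //= mcoeffZ mcoeffX eqxx mulr1 big1 ?addr0 //.
by move=> T neTS; rewrite mcoeffZ mcoeffX (inj_eq (@sqfree_mnm_inj n)) (negPf neTS) mulr0.
Qed.

Lemma msupp_sqfree_poly n (c : {set 'I_n} -> 'F_2) m :
  reflect (exists2 S, m = sqfree_mnm S & c S != 0) (m \in msupp (sqfree_poly c)).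
Proof.
rewrite mcoeff_msupp; apply: (iffP idP); last by case=> S ->; rewrite mcoeff_sqfree_poly.
rewrite raddf_sum /= => nz.
case: (pickP (fun S => (c S != 0) && (sqfree_mnm S == m))) => [S /andP[cS /eqP <-]|no].
  by exists S.
case/eqP: nz; apply: big1 => S _; rewrite mcoeffZ mcoeffX.
by have := no S; case: eqP => [->|_] //=; case: eqP => _ // _; rewrite ?mul0r ?mulr0.
Qed.

Definition chi n (S : {set 'I_n}) (i : 'I_n) : 'F_2 := (i \in S)%:R.

Lemma meval_sqfree_poly n (c : {set 'I_n} -> 'F_2) U :
  (sqfree_poly c).@[chi U] = mobius c U.
Proof.
rewrite raddf_sum /= /mobius [RHS]big_mkcond; apply: eq_bigr => S _ /=.
rewrite mevalZ mevalX; case: ifP => [sSU|/negbT/subsetPn[i iS niU]].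
  rewrite big1 ?mulr1 // => i _; rewrite mnmE /chi.
  by case: (boolP (i \in S)) => // /(subsetP sSU) ->.
by rewrite (bigD1 i) //= mnmE iS /chi (negPf niU) mul0r mulr0.
Qed.

(** The algebraic normal form of a Boolean function. *)
Definition anf n (f : {set 'I_n} -> 'F_2) := sqfree_poly (mobius f).

Lemma meval_anf n (f : {set 'I_n} -> 'F_2) U : (anf f).@[chi U] = f U.
Proof. by rewrite meval_sqfree_poly mobiusK. Qed.

(** The values of a squarefree polynomial are the Moebius transform of its
    coefficients, so transforming them again recovers the coefficients. *)
Lemma anf_meval n (Q : {mpoly 'F_2[n]}) :
  (forall m, m \in msupp Q -> forall i, (m i <= 1)%N) ->
  Q = anf (fun U => Q.@[chi U]).
Proof.
move=> sqf; pose c S := Q@_(sqfree_mnm S).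
have QE : Q = sqfree_poly c.
  apply/mpolyP => m; case: (boolP (m \in msupp Q)) => [mQ|nmQ].
    by rewrite (sqfree_mnmP (sqf m mQ)) mcoeff_sqfree_poly.
  rewrite (memN_msupp_eq0 nmQ); apply/esym/memN_msupp_eq0; apply: contra nmQ.
  by case/msupp_sqfree_poly=> S ->; rewrite mcoeff_msupp.
rewrite [LHS]QE; apply: eq_bigr => S _; congr (_ *: _).
rewrite -[LHS]mobiusK; apply: eq_bigr => T _.
by rewrite QE meval_sqfree_poly.
Qed.

Lemma eq_anf n (f g : {set 'I_n} -> 'F_2) : f =1 g -> anf f = anf g.
Proof.
move=> fg; apply: eq_bigr => S _; congr (_ *: _).
by apply: eq_bigr => T _; apply: fg.
Qed.

Lemma msize_anf n (f : {set 'I_n} -> 'F_2) :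
  (msize (anf f)).-1 = (\max_(S : {set 'I_n} | mobius f S != 0%R) #|S|)%N.
Proof.
rewrite msizeE; apply/eqP; rewrite eqn_leq; apply/andP; split; last first.
  apply/bigmax_leqP => S nz.
  have mS : sqfree_mnm S \in msupp (anf f) by apply/msupp_sqfree_poly; exists S.
  rewrite -(mdeg_sqfree S) -ltnS; apply: leq_trans (leqSpred _).
  exact: (@leq_bigmax_seq _ _ _ (fun m : 'X_{1..n} => (mdeg m).+1)).
rewrite -subn1 leq_subLR add1n; apply/bigmax_leqP_seq => m mQ _.
case/msupp_sqfree_poly: mQ => S -> nz; rewrite mdeg_sqfree ltnS.
exact: (@leq_bigmax_cond _ (fun S => mobius f S != 0) (fun S => #|S|)).
Qed.

(** * Vectors as lists of booleans *)

Definition bits n (S : {set 'I_n}) : bitseq := [seq i \in S | i <- enum 'I_n].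

Lemma size_bits n (S : {set 'I_n}) : size (bits S) = n.
Proof. by rewrite size_map size_enum_ord. Qed.

Lemma nth_bits n (S : {set 'I_n}) (i : 'I_n) : nth false (bits S) i = (i \in S).
Proof. by rewrite (nth_map i) ?size_enum_ord ?ltn_ord // nth_ord_enum. Qed.

Lemma bits_inj n : injective (@bits n).
Proof. by move=> S T e; apply/setP=> i; rewrite -!nth_bits e. Qed.

Lemma bits_set n (s : bitseq) : size s = n -> bits [set i : 'I_n | nth false s i] = s.
Proof.
move=> sz; apply: (@eq_from_nth _ false) => [|i]; rewrite size_bits // => lt_i.
by rewrite (nth_bits _ (Ordinal lt_i)) inE.
Qed.

Fixpoint cube n : seq bitseq :=
  if n is k.+1 then map (cons false) (cube k) ++ map (cons true) (cube k) else [:: [::]].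

Lemma mem_cube n s : (s \in cube n) = (size s == n).
Proof.
have cons_mem b c (L : seq bitseq) t : (b :: t \in map (cons c) L) = (b == c) && (t \in L).
  apply/mapP/andP => [[t' tL [-> ->]]|[/eqP -> tL]]; first by rewrite eqxx.
  by exists t.
elim: n s => [|n IH] [|b s] //=; rewrite mem_cat.
  by apply/negP=> /orP[] /mapP[].
by rewrite !cons_mem IH eqSS; case: b; rewrite ?orbF.
Qed.

Lemma cube_uniq n : uniq (cube n).
Proof.
elim: n => // n IH; rewrite /= cat_uniq !map_inj_uniq ?IH ?andbT //=; try by move=> ? ? [].
by apply/hasP=> -[s /mapP[t _ ->] /mapP[? _]].
Qed.

Lemma perm_bits_cube n : perm_eq [seq bits T | T <- index_enum {set 'I_n}] (cube n).
Proof.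
apply: uniq_perm; rewrite ?cube_uniq ?map_inj_uniq ?index_enum_uniq //; first exact: bits_inj.
move=> s; rewrite mem_cube; apply/mapP/eqP => [[S _ ->]|sz]; first exact: size_bits.
by exists [set i : 'I_n | nth false s i]; rewrite ?mem_index_enum ?bits_set.
Qed.

Lemma big_bits R (idx : R) (op : Monoid.com_law idx) n P (F : bitseq -> R) :
  \big[op/idx]_(S : {set 'I_n} | P (bits S)) F (bits S) = \big[op/idx]_(s <- cube n | P s) F s.
Proof. by rewrite -(perm_big _ (perm_bits_cube n)) /= big_map. Qed.

Definition supp n (x : 'cV['F_2]_n) : {set 'I_n} := [set i | x i 0 != 0].
Definition vec n (S : {set 'I_n}) : 'cV['F_2]_n := \col_i chi S i.

Lemma vecK n : cancel (@vec n) (@supp n).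
Proof. by move=> S; apply/setP=> i; rewrite inE mxE /chi; case: (_ \in _). Qed.

Lemma vec0 n : vec set0 = 0 :> 'cV['F_2]_n.
Proof. by apply/colP=> i; rewrite !mxE /chi inE. Qed.

Lemma chi_supp n (x : 'cV['F_2]_n) i : chi (supp x) i = x i 0.
Proof. by rewrite /chi inE -F2_boolE. Qed.

Lemma suppK n : cancel (@supp n) (@vec n).
Proof. by move=> x; apply/colP=> i; rewrite mxE chi_supp. Qed.

Definition code n (x : 'cV['F_2]_n) : bitseq := bits (supp x).

Lemma code_vec n (S : {set 'I_n}) : code (vec S) = bits S.
Proof. by rewrite /code vecK. Qed.

Lemma code_inj n : injective (@code n).
Proof. by move=> x y /bits_inj /(can_inj (@suppK n)). Qed.

Lemma size_code n (x : 'cV['F_2]_n) : size (code x) = n.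
Proof. exact: size_bits. Qed.

Lemma code_cube n (x : 'cV['F_2]_n) : code x \in cube n.
Proof. by rewrite mem_cube size_code. Qed.

Lemma code_all n (P : pred bitseq) : all P (cube n) -> forall x : 'cV['F_2]_n, P (code x).
Proof. by move=> /allP allP x; apply/allP/code_cube. Qed.

Lemma nth_code n (x : 'cV['F_2]_n) (i : 'I_n) : nth false (code x) i = (x i 0 != 0).
Proof. by rewrite nth_bits inE. Qed.

Lemma code_ex n s : size s = n -> exists x : 'cV['F_2]_n, code x = s.
Proof. by move=> sz; exists (vec [set i : 'I_n | nth false s i]); rewrite code_vec bits_set. Qed.

Lemma eq_code n (x : 'cV['F_2]_n) s : size s = n ->
  (forall i : 'I_n, nth false s i = (x i 0 != 0)) -> code x = s.
Proof.
move=> sz e; apply: (@eq_from_nth _ false); rewrite size_code // => i lt_i.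
by rewrite (nth_code x (Ordinal lt_i)) -e.
Qed.

Definition xor_bits (s t : bitseq) : bitseq := [seq p.1 (+) p.2 | p <- zip s t].

Lemma nth_xor_bits s t i : size s = size t ->
  nth false (xor_bits s t) i = nth false s i (+) nth false t i.
Proof.
move=> e; case: (ltnP i (size s)) => lt_i.
  by rewrite (nth_map (false, false)) ?size_zip -?e ?minnn // nth_zip.
by rewrite !nth_default // ?size_map ?size_zip -?e ?minnn.
Qed.

Lemma F2_add_neq0 (a b : 'F_2) : (a + b != 0) = (a != 0) (+) (b != 0).
Proof. by rewrite {1}(F2_boolE a) {1}(F2_boolE b); case: (a != 0); case: (b != 0). Qed.

Lemma F2_mul_neq0 (a b : 'F_2) : (a * b != 0) = (a != 0) && (b != 0).
Proof. by rewrite mulf_eq0 negb_or. Qed.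

Lemma codeD n (x y : 'cV['F_2]_n) : code (x + y) = xor_bits (code x) (code y).
Proof.
apply: eq_code => [|i]; first by rewrite size_map size_zip !size_code minnn.
by rewrite nth_xor_bits ?size_code // !nth_code mxE F2_add_neq0.
Qed.

Lemma code_neq0 n (x : 'cV['F_2]_n) : (x != 0) = (true \in code x).
Proof.
apply/idP/idP; last first.
  apply: contraTneq => ->; apply/(nthP false) => -[i]; rewrite size_code => lt_i.
  by rewrite (nth_code 0 (Ordinal lt_i)) mxE eqxx.
apply: contraR => no; apply/eqP/colP=> i; rewrite mxE; apply/eqP.
apply: contraR no => xi; apply/(nthP false); exists i; first by rewrite size_code.
by rewrite nth_code.
Qed.

(** The index of the tensor product is i * n + j, as in [mxtens_index]. *)
Definition tens_bits (s t : bitseq) : bitseq :=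
  mkseq (fun i => nth false s (i %/ size t)%N && nth false t (i %% size t)%N) (size s * size t).

Lemma code_tens m n (a : 'cV['F_2]_m) (b : 'cV['F_2]_n) :
  code (a *t b : 'cV['F_2]_(m * n)) = tens_bits (code a) (code b).
Proof.
apply: eq_code => [|i]; first by rewrite size_mkseq !size_code.
rewrite nth_mkseq !size_code // mxE F2_mul_neq0.
rewrite (nth_code a (mxtens_unindex i).1) (nth_code b (mxtens_unindex i).2).
by congr ((a _ _ != 0) && (b _ _ != 0)); apply/esym/ord1.
Qed.

Lemma code0 n : code (0 : 'cV['F_2]_n) = nseq n false.
Proof. by apply: eq_code => [|i]; rewrite ?size_nseq // mxE nth_nseq ltn_ord eqxx. Qed.

Lemma addvv n (x : 'cV['F_2]_n) : x + x = 0.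
Proof. by rewrite -mulr2n; apply/colP=> i; rewrite mulmxnE F2_mulr2n mxE. Qed.

(** Over GF(2), adjoining v to a subspace M not containing it adds the coset v + M. *)
Fixpoint span_list n (L : seq 'cV['F_2]_n) : seq 'cV['F_2]_n :=
  if L is v :: L' then
    let M := span_list L' in if v \in M then M else M ++ map (+%R v) M
  else [:: 0].

Lemma mem_span_list n (L : seq 'cV['F_2]_n) : span_list L =i <<L>>%VS.
Proof.
elim: L => [|v L IH] x /=; first by rewrite span_nil memv0 inE.
rewrite span_cons IH; case: ifP => [vL|_].
  by rewrite (addv_idPr _) ?IH // -memvE.
rewrite mem_cat IH; have -> : (x \in map (+%R v) (span_list L)) = (v + x \in <<L>>%VS).
  rewrite -IH; apply/mapP/idP => [[w wL ->]|xL]; first by rewrite addrA addvv add0r.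
  by exists (v + x); rewrite // addrA addvv add0r.
apply/orP/memv_addP => [[xL|xL]|[_ /vlineP[k ->] [w wL ->]]].
- by exists 0; rewrite ?mem0v //; exists x; rewrite ?add0r.
- by exists v; rewrite ?memv_line //; exists (v + x); rewrite // addrA addvv add0r.
rewrite (F2_boolE k); case: (k != 0); rewrite ?scale0r ?add0r ?scale1r; last by left.
by right; rewrite addrA addvv add0r.
Qed.

Fixpoint span_bits n (L : seq bitseq) : seq bitseq :=
  if L is v :: L' then
    let M := span_bits n L' in if v \in M then M else M ++ map (xor_bits v) M
  else [:: nseq n false].

Lemma code_span_list n (L : seq 'cV['F_2]_n) :
  map (@code n) (span_list L) = span_bits n (map (@code n) L).
Proof.
elim: L => [|v L IH] /=; first by rewrite code0.
rewrite -IH (mem_map (@code_inj n)); case: ifP => // _.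
rewrite map_cat -!map_comp; congr (_ ++ _).
by apply: eq_map => x /=; rewrite codeD.
Qed.

Definition flat_bits (L : seq bitseq) := [seq s <- span_bits 8 L | true \in s].

(** The size hypothesis makes every entry of L the code of a vector of V8. *)
Lemma mem_flat_code (X : {set V8}) (L : seq bitseq) :
  (forall y, (y \in X) = (code y \in L)) -> all (fun s => size s == 8) L ->
  forall x, (x \in flat X) = (code x \in flat_bits L).
Proof.
move=> XL szL x; rewrite inE code_neq0 mem_filter; congr (_ && _).
have [L' eL] : exists L' : seq V8, map (@code _) L' = L.
  elim: L szL {XL} => [|s L IH] /=; first by exists [::].
  case/andP=> /eqP/(@code_ex 8)[y <-] /IH[L' <-]; by exists (y :: L').
rewrite -eL -code_span_list (mem_map (@code_inj _)) mem_span_list.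
rewrite (@eq_span _ _ (enum X) L') // => y.
by rewrite mem_enum XL -eL mem_map //; apply: code_inj.
Qed.

(** * The Segre variety and the five point sets as computed lists *)

Definition I3 := iota 0 3.
Definition triple_codes : seq (seq nat) :=
  flatten [seq [seq [:: i; j; k] | j <- I3, k <- I3] | i <- I3].
(** The vectors 10, 01, 11. *)
Definition u_bits (i : nat) : bitseq := [:: i != 1%N; i != 0%N].
Definition E_bits (t : seq nat) : bitseq :=
  tens_bits (tens_bits (u_bits (nth 0%N t 0)) (u_bits (nth 0%N t 1))) (u_bits (nth 0%N t 2)).

Definition triple_code (t : triple) : seq nat := [seq val (t m) | m <- enum 'I_3].

Lemma nth_triple_code (t : triple) (m : 'I_3) : nth 0%N (triple_code t) m = t m.
Proof. by rewrite (nth_map m) ?size_enum_ord // nth_ord_enum. Qed.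

Lemma mem_I3 m : (m \in I3) = (m < 3)%N.
Proof. by rewrite mem_iota. Qed.

Lemma forall_I3 (P : pred 'I_3) (P' : pred nat) :
  (forall m, P m = P' (val m)) -> [forall m, P m] = all P' I3.
Proof.
move=> PP'; apply/forallP/allP => [allP m|allP m]; last first.
  by rewrite PP'; apply: allP; rewrite mem_I3 ltn_ord.
by rewrite mem_I3 => lt_m; have := allP (Ordinal lt_m); rewrite PP'.
Qed.

Lemma mem_triple_codes s :
  (s \in triple_codes) = (size s == 3) && all (fun i => i \in I3) s.
Proof.
apply/flatten_mapP/andP => [[i iI /allpairsP[[j k] /= [jI kI ->]]]|].
  by split; rewrite /all ?iI ?jI ?kI.
case; case: s => [|i [|j [|k [|? ?]]]] // _; rewrite /all => /and4P[iI jI kI _].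
by exists i => //; apply/allpairsP; exists (j, k).
Qed.

Lemma triple_code_mem t : triple_code t \in triple_codes.
Proof.
rewrite mem_triple_codes size_map size_enum_ord /=.
by apply/allP => _ /mapP[m _ ->]; rewrite mem_I3 ltn_ord.
Qed.

Lemma triple_codeP s : s \in triple_codes -> exists t, triple_code t = s.
Proof.
rewrite mem_triple_codes => /andP[/eqP sz /allP lt3].
exists [ffun m : 'I_3 => inord (nth 0%N s m)].
apply: (@eq_from_nth _ 0%N) => [|i]; first by rewrite size_map size_enum_ord sz.
rewrite size_map size_enum_ord => lt_i.
rewrite (nth_triple_code _ (Ordinal lt_i)) ffunE inordK //=.
by rewrite -mem_I3 lt3 // mem_nth ?sz.
Qed.

Lemma code_u (i : 'I_3) : code (u i) = u_bits i.
Proof.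
apply: eq_code => // j; rewrite /u.
by case: i => [[|[|[|]]]] //= _; case: j => [[|[|]]] //= lt_j; rewrite !mxE.
Qed.

Lemma code_E t : code (E t) = E_bits (triple_code t).
Proof.
rewrite /E /E_bits.
have nth_inord k : (k < 3)%N -> nth 0%N (triple_code t) k = t (inord k).
  by move=> lt_k; rewrite -nth_triple_code inordK.
by rewrite !nth_inord // -!code_u -(@code_tens 2 2) -(@code_tens 4 2).
Qed.

Definition cup_bits (P : pred nat) (F : nat -> seq bitseq) : seq bitseq :=
  flatten [seq F m | m <- I3 & P m].

Lemma mem_cup_bits (P : pred 'I_3) (P' : pred nat)
    (F : 'I_3 -> {set V8}) (F' : nat -> seq bitseq) :
  (forall m, P m = P' (val m)) ->
  (forall (m : 'I_3) x, (x \in F m) = (code x \in F' m)) ->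
  forall x, (x \in \bigcup_(m | P m) F m) = (code x \in cup_bits P' F').
Proof.
move=> PP' FF' x; apply/bigcupP/flatten_mapP => [[m Pm xF]|[m]].
  by exists (val m); rewrite ?mem_filter -?PP' ?Pm ?mem_I3 ?ltn_ord -?FF'.
rewrite mem_filter mem_I3 => /andP[Pm lt_m] xF.
by exists (Ordinal lt_m); rewrite ?PP' // FF'.
Qed.

Lemma mem_E_bits (P : pred triple) (P' : pred (seq nat)) :
  (forall t, P t = P' (triple_code t)) ->
  forall x, (x \in [set E t | t : triple & P t]) =
            (code x \in [seq E_bits t | t <- triple_codes & P' t]).
Proof.
move=> PP' x; apply/imsetP/mapP => [[t]|[s /[!mem_filter] /andP[Ps /triple_codeP[t et]] e]].
  rewrite inE => Pt ->; exists (triple_code t); last exact: code_E.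
  by rewrite mem_filter -PP' Pt triple_code_mem.
exists t; first by rewrite inE PP' et.
by apply: code_inj; rewrite e code_E et.
Qed.

Definition slice_bits (m a : nat) := [seq E_bits t | t <- triple_codes & nth 0%N t m == a].
Definition generator_bits (t : seq nat) (m : nat) :=
  [seq E_bits r | r <- triple_codes & all (fun n => (n != m) ==> (nth 0%N r n == nth 0%N t n)) I3].
Definition tangent_bits t : seq bitseq :=
  E_bits t :: [seq s <- flat_bits (cup_bits predT (generator_bits t)) |
             s \notin cup_bits predT (fun m => flat_bits (cup_bits (predC1 m) (generator_bits t)))].

(** Each list comes with its normal form, so that further evaluations start
    from explicit lists of vectors. *)
Definition Segre_list := map E_bits triple_codes.
Definition Segre_bits := Eval vm_compute in Segre_list.
Definition O2_list :=
  [seq s <- undup (cup_bits predT (fun m =>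
              cup_bits predT (fun a => flat_bits (slice_bits m a)))) |
     s \notin Segre_bits].
Definition O2_bits := Eval vm_compute in O2_list.
Definition O3_list :=
  undup (flatten
    [seq [seq xor_bits (E_bits r) (E_bits t) |
            t <- triple_codes & all (fun m => nth 0%N r m != nth 0%N t m) I3] |
       r <- triple_codes]).
Definition O3_bits := Eval vm_compute in O3_list.
Definition O4_list :=
  [seq s <- undup (flatten [seq tangent_bits t | t <- triple_codes]) | s \notin Segre_bits].
Definition O4_bits := Eval vm_compute in O4_list.
Definition O1_list :=
  [seq s <- cube 8 | (true \in s) && (s \notin O2_bits ++ O3_bits ++ O4_bits ++ Segre_bits)].
Definition O1_bits := Eval vm_compute in O1_list.

Lemma mem_Segre x : (x \in Segre) = (code x \in Segre_bits).
Proof.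
have -> : Segre_bits = Segre_list by vm_compute.
rewrite /Segre_list -[triple_codes]filter_predT -(mem_E_bits (P := predT)) //.
by apply/imsetP/imsetP => -[t _ ->]; exists t; rewrite ?inE.
Qed.

Lemma mem_slice m a x : (x \in slice m a) = (code x \in slice_bits m a).
Proof. by apply: mem_E_bits => t; rewrite nth_triple_code. Qed.

Lemma mem_generator t m x : (x \in generator t m) = (code x \in generator_bits (triple_code t) m).
Proof. by apply: mem_E_bits => r; apply: forall_I3 => n; rewrite !nth_triple_code. Qed.

Lemma all_size_E_bits (T : Type) (r : seq T) f :
  all (fun s => size s == 8) [seq E_bits (f t) | t <- r].
Proof. by elim: r. Qed.

Lemma all_size_cup_bits P F : (forall m, all (fun s : bitseq => size s == 8) (F m)) ->
  all (fun s => size s == 8) (cup_bits P F).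
Proof.
by move=> allF; apply/allP => s /flatten_mapP[m _]; apply: (allP (allF m)).
Qed.

Lemma mem_tangent t x : (x \in tangent t) = (code x \in tangent_bits (triple_code t)).
Proof.
have szg P : all (fun s => size s == 8) (cup_bits P (generator_bits (triple_code t))).
  by apply: all_size_cup_bits => m; apply: all_size_E_bits.
rewrite in_setU1 in_setD in_cons -(inj_eq (@code_inj 8)) code_E mem_filter.
congr (_ || ~~ _ && _).
  apply: mem_cup_bits => // m y; apply: mem_flat_code => // z.
  by apply: mem_cup_bits => // n w; apply: mem_generator.
apply: mem_flat_code => // z.
by apply: mem_cup_bits => // n w; apply: mem_generator.
Qed.

Lemma mem_O2 x : (x \in O2) = (code x \in O2_bits).
Proof.
have -> : O2_bits = O2_list by vm_compute.
rewrite /O2_list in_setD mem_filter mem_undup mem_Segre; congr (_ && _).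
apply: mem_cup_bits => // m y; apply: mem_cup_bits => // a z.
apply: mem_flat_code => [w|]; [exact: mem_slice|exact: all_size_E_bits].
Qed.

Lemma mem_O4 x : (x \in O4) = (code x \in O4_bits).
Proof.
have -> : O4_bits = O4_list by vm_compute.
rewrite /O4_list in_setD mem_filter mem_undup mem_Segre; congr (_ && _).
apply/bigcupP/flatten_mapP => [[t _]|[_ /triple_codeP[t <-]]]; rewrite -?mem_tangent => xt.
  by exists (triple_code t); rewrite ?triple_code_mem -?mem_tangent.
by exists t.
Qed.

Lemma mem_O3 x : (x \in O3) = (code x \in O3_bits).
Proof.
have -> : O3_bits = O3_list by vm_compute.
have neqE (r t : triple) : [forall m, r m != t m] =
    all (fun m => nth 0%N (triple_code r) m != nth 0%N (triple_code t) m) I3.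
  by apply: forall_I3 => m; rewrite !nth_triple_code.
rewrite /O3_list mem_undup; apply/imsetP/flatten_mapP.
  case=> -[r t]; rewrite inE => ne ->; exists (triple_code r); first exact: triple_code_mem.
  have {}ne : [forall m, r m != t m] by [].
  rewrite codeD !code_E; apply/mapP; exists (triple_code t) => //.
  by rewrite mem_filter -neqE ne triple_code_mem.
case=> _ /triple_codeP[r <-] /mapP[s /[!mem_filter] /andP[ne /triple_codeP[t et]] e].
exists (r, t); first by rewrite inE neqE et.
by apply: code_inj; rewrite e codeD !code_E et.
Qed.

Lemma mem_O1 x : (x \in O1) = (code x \in O1_bits).
Proof.
have -> : O1_bits = O1_list by vm_compute.
rewrite /O1_list mem_filter code_cube andbT !mem_cat.
by rewrite -mem_Segre -mem_O2 -mem_O3 -mem_O4 -code_neq0 !inE !orbA andbC.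
Qed.

(** * Invariance of the five sets *)

(** For X the Segre variety and x nonzero, this is twice the number of
    unordered pairs of Segre points with sum x. *)
Definition reps (X : {set V8}) (x : V8) : nat := #|[set p in Segre | x + p \in X]|.

(** The number i of the set O_i containing the point x, and 0 for the zero
    vector.  It is defined through GS-invariant quantities only, given that O3
    is invariant; that it does number the O_i is [mem_orbits]. *)
Definition orbit_index (x : V8) : nat :=
  if x == 0 then 0 else if x \in Segre then 5 else
  if reps Segre x == 6 then 2 else if reps Segre x == 2 then 3 else
  if reps O3 x == 12 then 4 else 1.

Definition reps_bits (L : seq bitseq) (s : bitseq) : nat :=
  count (fun p => xor_bits s p \in L) Segre_bits.
Definition index_bits (s : bitseq) : nat :=
  if true \notin s then 0 else if s \in Segre_bits then 5 else
  if reps_bits Segre_bits s == 6 then 2 else if reps_bits Segre_bits s == 2 then 3 else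
  if reps_bits O3_bits s == 12 then 4 else 1.

Lemma reps_code (X : {set V8}) (L : seq bitseq) : (forall x, (x \in X) = (code x \in L)) ->
  forall x, reps X x = reps_bits L (code x).
Proof.
move=> XL x; rewrite /reps /reps_bits.
have pS : perm_eq [seq code p | p <- enum Segre] Segre_bits.
  apply: uniq_perm; [by rewrite map_inj_uniq ?enum_uniq //; apply: code_inj|by vm_compute|].
  move=> s; apply/mapP/idP => [[p /[!mem_enum] pS ->]|sS]; first by rewrite -mem_Segre.
  have sz : size s = 8.
    by apply/eqP; apply: (allP (_ : all (fun s => size s == 8) Segre_bits)) sS.
  have [p ep] := @code_ex 8 s sz; exists p => //.
  by rewrite mem_enum mem_Segre ep.
rewrite -(seq.permP pS) count_map cardE -size_filter.
apply: perm_size; apply: uniq_perm => [||p]; [exact: enum_uniq|exact/filter_uniq/enum_uniq|].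
by rewrite mem_enum [RHS]mem_filter mem_enum inE andbC /= XL codeD.
Qed.

Lemma orbit_indexE x : orbit_index x = index_bits (code x).
Proof.
rewrite /orbit_index /index_bits -code_neq0 -mem_Segre negbK.
by rewrite -(reps_code mem_Segre) -(reps_code mem_O3).
Qed.

(** Two points E t, E t' with t, t' different in all three positions are the
    only Segre points adding up to their sum.  This makes O3 invariant. *)
Lemma mem_O3_reps x : (x \in O3) = (reps Segre x == 2).
Proof.
rewrite mem_O3 (reps_code mem_Segre); apply/eqP.
pose P s := (s \in O3_bits) == (reps_bits Segre_bits s == 2).
by apply: (@code_all 8 P); vm_compute.
Qed.

(** A induces a bijection between the Segre points counted for x and those
    counted for A *m x. *)
Lemma reps_GS A (X : {set V8}) x : A \in GS -> (forall y, (A *m y \in X) = (y \in X)) ->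
  reps X (A *m x) = reps X x.
Proof.
move=> /[!inE] /andP[uA /eqP AS] AX.
have injA : injective (mulmx A : V8 -> V8) := can_inj (mulKmx uA).
rewrite /reps -[RHS](card_imset _ injA); apply: eq_card => p; rewrite inE.
apply/andP/imsetP => [[]|[p' /[!inE] /andP[pS xpX] ->]].
  rewrite -{1}AS => /imsetP[p' pS ->]; rewrite -mulmxDr AX => xpX.
  by exists p'; rewrite // inE pS.
by rewrite -mulmxDr AX xpX -AS imset_f.
Qed.

Lemma Segre_GS A x : A \in GS -> (A *m x \in Segre) = (x \in Segre).
Proof.
move=> /[!inE] /andP[uA /eqP AS]; rewrite -{1}AS.
by rewrite mem_imset //; apply: can_inj (mulKmx uA).
Qed.

Lemma orbit_index_GS A x : A \in GS -> orbit_index (A *m x) = orbit_index x.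
Proof.
move=> AG; have repsS y : reps Segre (A *m y) = reps Segre y.
  by apply: reps_GS => // z; apply: Segre_GS.
rewrite /orbit_index Segre_GS // repsS (reps_GS _ AG) => [|y]; last first.
  by rewrite !mem_O3_reps repsS.
suff -> : (A *m x == 0) = (x == 0) by [].
move: AG => /[!inE] /andP[uA _]; rewrite -{1}(mulmx0 _ A) inj_eq //.
exact: can_inj (mulKmx uA).
Qed.

Definition orbits_bits := [:: [:: nseq 8 false]; O1_bits; O2_bits; O3_bits; O4_bits; Segre_bits].
Definition orbits := [:: [set 0]; O1; O2; O3; O4; O5].

Lemma index_bits_orbits k : (k < 6)%N -> all (fun s => index_bits s == k) (nth [::] orbits_bits k).
Proof.
have /allP H : all (fun k => all (fun s => index_bits s == k) (nth [::] orbits_bits k)) (iota 0 6).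
  by vm_compute.
by move=> lt_k; apply: H; rewrite mem_iota.
Qed.

(** The lists cover the cube, and the index is constant, equal to k, on the
    k-th list; hence it is k nowhere else. *)
Lemma mem_orbits k x : (k < 6)%N -> (x \in nth set0 orbits k) = (orbit_index x == k).
Proof.
have memE j : (j < 6)%N -> (x \in nth set0 orbits j) = (code x \in nth [::] orbits_bits j).
  case: j => [|[|[|[|[|[|]]]]]] // _.
  - by rewrite [LHS]in_set1 [RHS]mem_seq1 -code0 (inj_eq (@code_inj 8)).
  - exact: mem_O1.
  - exact: mem_O2.
  - exact: mem_O3.
  - exact: mem_O4.
  - exact: mem_Segre.
move=> lt_k; rewrite memE // orbit_indexE; apply/idP/eqP => [|ex].
  by move/(allP (index_bits_orbits lt_k))/eqP.
pose P s := has (fun j => s \in nth [::] orbits_bits j) (iota 0 6).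
have /(@code_all 8)/(_ x)/hasP[j] : all P (cube 8) by vm_compute.
rewrite mem_iota => lt_j xj.
by have := allP (index_bits_orbits lt_j) _ xj; rewrite ex => /eqP ->.
Qed.

(** * Each of the five sets is a single orbit *)

Definition dot_bits (r s : bitseq) : bool := foldr addb false [seq p.1 && p.2 | p <- zip r s].
Definition act_bits (g : seq bitseq) (s : bitseq) := [seq dot_bits r s | r <- g].
Definition mx_of (g : seq bitseq) : 'M['F_2]_8 :=
  \matrix_(i, j) (nth false (nth [::] g i) j)%:R.

Lemma dot_bits_sum n r s : size r = n -> size s = n ->
  dot_bits r s = (\sum_(j < n) (nth false r j && nth false s j)%:R != 0 :> 'F_2).
Proof.
elim: n r s => [|n IH] [|a r] [|b s] //=; first by rewrite big_ord0 eqxx.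
move=> [szr] [szs]; rewrite big_ord_recl F2_add_neq0 -IH //.
by rewrite /dot_bits /=; case: (a && b).
Qed.

Lemma code_mx_of g x : size g = 8 -> all (fun r => size r == 8) g ->
  code (mx_of g *m x) = act_bits g (code x).
Proof.
move=> szg szr; apply: eq_code => [|i]; first by rewrite size_map.
rewrite (nth_map [::]) ?szg // (@dot_bits_sum 8) ?size_code //; last first.
  by apply/eqP/(allP szr)/mem_nth; rewrite szg.
rewrite mxE; congr (_ != 0); apply: eq_bigr => j _.
by rewrite mxE nth_code [in RHS](F2_boolE (x j 0)) -natrM mulnb.
Qed.

Definition kron_bits (g h : seq bitseq) := [seq tens_bits r s | r <- g, s <- h].
Definition id_rows : seq bitseq := [:: [:: true; false]; [:: false; true]].
Definition swap_rows : seq bitseq := rev id_rows.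
Definition transvection_rows : seq bitseq := [:: [:: true; true]; [:: false; true]].
(** The exchange of two tensor factors. *)
Definition flip_rows := [seq tens_bits y x | x <- id_rows, y <- id_rows].
(** On V2, the swap and the transvection generate GL(V2).  Acting on the first
    factor, together with two adjacent exchanges of factors, they generate the
    group N : Sym(3).  All four matrices are involutions, which makes
    invertibility and the stability of the Segre variety immediate to check. *)
Definition generator_rows : seq (seq bitseq) := Eval vm_compute in
  [:: kron_bits (kron_bits swap_rows id_rows) id_rows;
      kron_bits (kron_bits transvection_rows id_rows) id_rows;
      kron_bits flip_rows id_rows; kron_bits id_rows flip_rows].

Lemma code_generator_rows g x : g \in generator_rows -> code (mx_of g *m x) = act_bits g (code x).
Proof.
have /allP H : all (fun g => (size g == 8) && all (fun r => size r == 8) g) generator_rows.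
  by vm_compute.
by case/H/andP=> /eqP szg szr; apply: code_mx_of.
Qed.

Lemma generator_rows_GS g : g \in generator_rows -> mx_of g \in GS.
Proof.
move=> gG; have /allP/(_ g gG)/andP[/allP inv /allP sub] :
    all (fun g => all (fun s => act_bits g (act_bits g s) == s) (cube 8) &&
      all (fun s => act_bits g s \in Segre_bits) Segre_bits) generator_rows.
  by vm_compute.
have invx (x : V8) : mx_of g *m (mx_of g *m x) = x.
  by apply: code_inj; rewrite !code_generator_rows //; apply/eqP/inv/code_cube.
have gS x : x \in Segre -> mx_of g *m x \in Segre.
  by rewrite !mem_Segre code_generator_rows // => /sub.
rewrite inE; apply/andP; split.
  suff /mulmx1_unit[] : mx_of g *m mx_of g = 1%:M by [].
  apply/matrixP=> i j; have /colP/(_ i) := invx (delta_mx j 0).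
  by rewrite mulmxA -colE [LHS]mxE => ->; rewrite !mxE eqxx andbT.
apply/eqP/setP=> x; apply/imsetP/idP => [[y yS ->]|xS]; first exact: gS.
by exists (mx_of g *m x); rewrite ?gS ?invx.
Qed.

(** Breadth-first exploration under the four involutions: [front] is the part of
    [seen] found in the last round. *)
Fixpoint bfs k (seen front : seq bitseq) :=
  if k is k'.+1 then
    let new := [seq s <- undup [seq act_bits g s | g <- generator_rows, s <- front] |
                  s \notin seen] in
    bfs k' (seen ++ new) new
  else seen.

Lemma bfs_ind (P : bitseq -> Prop) k seen front :
  (forall g s, g \in generator_rows -> P s -> P (act_bits g s)) ->
  (forall s, s \in seen -> P s) -> (forall s, s \in front -> P s) ->
  forall s, s \in bfs k seen front -> P s.
Proof.
move=> Pact; elim: k seen front => [|k IH] seen front Pseen Pfront //.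
pose new := [seq s <- undup [seq act_bits g s | g <- generator_rows, s <- front] |
               s \notin seen].
have Pnew s : s \in new -> P s.
  rewrite mem_filter mem_undup => /andP[_ /allpairsP[[g t] [gG tF ->]]].
  by apply: Pact => //; apply: Pfront.
by apply: (IH (seen ++ new) new) => // s; rewrite mem_cat => /orP[/Pseen|/Pnew].
Qed.

Definition rep_bits (k : nat) : bitseq := head [::] (nth [::] orbits_bits k).
Definition orbit_rep (k : nat) : V8 := vec [set i : 'I_8 | nth false (rep_bits k) i].

Lemma code_orbit_rep k : (k < 6)%N -> code (orbit_rep k) = rep_bits k.
Proof.
move=> lt_k; rewrite code_vec bits_set //; apply/eqP.
have /allP : all (fun k => size (rep_bits k) == 8) (iota 0 6) by vm_compute.
by apply; rewrite mem_iota.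
Qed.

Lemma orbit_index_rep k : (k < 6)%N -> orbit_index (orbit_rep k) = k.
Proof.
move=> lt_k; rewrite orbit_indexE code_orbit_rep //; apply/eqP.
have /allP : all (fun k => index_bits (rep_bits k) == k) (iota 0 6) by vm_compute.
by apply; rewrite mem_iota.
Qed.

Lemma orbit_index_lt x : (orbit_index x < 6)%N.
Proof. by rewrite orbit_indexE /index_bits; do !case: ifP. Qed.

(** Every vector is reached by the exploration from the representative of its
    class; the value of f is transported along the involutions. *)
Lemma GS_invariant_orbit_rep (T : Type) (f : V8 -> T) :
  (forall A x, A \in GS -> f (A *m x) = f x) -> forall x, f x = f (orbit_rep (orbit_index x)).
Proof.
move=> fG x; set k := orbit_index x.
have lt_k : (k < 6)%N := orbit_index_lt x.
pose r := rep_bits k.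
(* Twelve rounds are enough to exhaust the largest orbit. *)
have xk : code x \in bfs 12 [:: r] [:: r].
  have /allP/(_ k) : all (fun k =>
      let r := rep_bits k in
      let R := bfs 12 [:: r] [:: r] in
      all (fun s => s \in R) (nth [::] orbits_bits k)) (iota 0 6).
    by vm_compute.
  rewrite mem_iota => /(_ lt_k) /allP; apply.
  pose P s := s \in nth [::] orbits_bits (index_bits s).
  have /(@code_all 8)/(_ x) : all P (cube 8) by vm_compute.
  by rewrite /P -orbit_indexE.
have Pr s : s \in [:: r] -> exists2 y : V8, code y = s & f y = f (orbit_rep k).
  by rewrite inE => /eqP ->; exists (orbit_rep k); rewrite ?code_orbit_rep.
have [|y /code_inj -> //] := bfs_ind _ Pr Pr xk.
move=> g _ gG [y <- fy]; exists (mx_of g *m y); first exact: code_generator_rows.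
by rewrite fG ?generator_rows_GS.
Qed.

(** * The invariant polynomials *)

Lemma peval_supp Q x : peval Q x = Q.@[chi (supp x)].
Proof. by apply: meval_eq => i; rewrite chi_supp. Qed.

Lemma odd_F2 n : (n%:R != 0 :> 'F_2) = odd n.
Proof.
elim: n => [|n IH]; first by rewrite eqxx.
by rewrite mulrS F2_add_neq0 IH.
Qed.

Definition support_of (a : {set 'I_4}) : {set V8} := \bigcup_(i in ~: a) O_ i.
Definition invariant_poly (a : {set 'I_4}) : {mpoly 'F_2[8]} :=
  anf (fun T => (vec T \in support_of a)%:R).

Lemma mem_O_ (i : 'I_4) x : (x \in O_ i) = (orbit_index x == i.+1).
Proof. by case: i => [[|[|[|[|]]]]] // lt_i; rewrite -mem_orbits. Qed.

(** The defaults encode the two remaining classes: the zero vector (index 0) and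
    O5 (index 5, beyond the end of the list) are outside of every support. *)
Lemma mem_support_of a x :
  (x \in support_of a) = ~~ nth true (true :: bits a) (orbit_index x).
Proof.
apply/bigcupP/idP => [[i /[!inE] nia]|].
  by rewrite mem_O_ => /eqP ->; rewrite /= (set_nth_default false) ?size_bits ?nth_bits.
case ek: (orbit_index x) => [|k] //=; case: (ltnP k 4) => [lt_k|le_k]; last first.
  by rewrite nth_default ?size_bits.
rewrite (set_nth_default false) ?size_bits // (nth_bits _ (Ordinal lt_k)) => nka.
by exists (Ordinal lt_k); rewrite ?inE // mem_O_ ek.
Qed.

Lemma peval_invariant_poly a x : peval (invariant_poly a) x = (x \in support_of a)%:R.
Proof. by rewrite peval_supp meval_anf suppK. Qed.

Lemma invariant_poly_reduced a : reduced (invariant_poly a).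
Proof.
move=> m /msupp_sqfree_poly[S -> nz]; split; last by move=> i; rewrite mnmE; case: (_ \in _).
apply: contraNneq nz; rewrite -sqfree_mnm0 => /sqfree_mnm_inj ->.
by rewrite mobius_set0 vec0 mem_support_of /orbit_index eqxx.
Qed.

Lemma invariant_poly_GS a : GS_invariant (invariant_poly a).
Proof. by move=> A x AG; rewrite !peval_invariant_poly !mem_support_of orbit_index_GS. Qed.

Lemma zero_set_invariant_poly a : zero_set (invariant_poly a) = O5 :|: \bigcup_(i in a) O_ i.
Proof.
apply/setP=> x; rewrite !inE peval_invariant_poly mem_support_of.
have -> : (x \in O5) = (orbit_index x == 5%N) by rewrite -mem_orbits.
have -> : (x == 0) = (orbit_index x == 0%N) by rewrite -mem_orbits // in_set1.
have -> : (x \in \bigcup_(i in a) O_ i) = nth false (false :: bits a) (orbit_index x).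
  apply/bigcupP/idP => [[i ia]|]; first by rewrite mem_O_ => /eqP ->; rewrite /= nth_bits.
  case ek: (orbit_index x) => [|k] //=; case: (ltnP k 4) => [lt_k|le_k]; last first.
    by rewrite nth_default ?size_bits.
  rewrite (nth_bits _ (Ordinal lt_k)) => ka.
  by exists (Ordinal lt_k); rewrite ?mem_O_ ?ek.
have := orbit_index_lt x; case: (orbit_index x) => [|k] //=.
rewrite eqSS !ltnS leq_eqVlt; case: eqP => [->|_] /= lt_k.
  by rewrite nth_default ?size_bits.
by rewrite [nth true _ _](set_nth_default false) ?size_bits //; case: nth.
Qed.

(** * Degrees *)

Definition le_bits (s t : bitseq) := all (fun p => p.1 ==> p.2) (zip s t).

Lemma subset_bits n (S T : {set 'I_n}) : le_bits (bits S) (bits T) = (S \subset T).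
Proof.
rewrite /le_bits /bits zip_map all_map; apply/allP/subsetP => [all_le i iS|sST i _].
  by have /implyP := all_le i (mem_enum _ i); apply.
by apply/implyP/sST.
Qed.

Definition index_table := Eval vm_compute in [seq (s, index_bits s) | s <- cube 8].
Definition support_bits (b : bitseq) : seq bitseq :=
  [seq p.1 | p <- index_table & ~~ nth true (true :: b) p.2].
(** The largest size of a set S below which there is an odd number of support
    vectors, i.e. whose monomial has coefficient 1. *)
Definition degree_bits (b : bitseq) : nat :=
  let L := support_bits b in
  foldr maxn 0%N [seq count id s | s <- cube 8 & odd (count (le_bits^~ s) L)].

Lemma mobius_bits a S :
  (mobius (fun T => (vec T \in support_of a)%:R) S != 0) =
  odd (count (le_bits^~ (bits S)) (support_bits (bits a))).
Proof.
rewrite -odd_F2; congr (_ != 0).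
have -> : support_bits (bits a) =
    [seq s <- cube 8 | ~~ nth true (true :: bits a) (index_bits s)].
  have tE : index_table = [seq (s, index_bits s) | s <- cube 8] by vm_compute.
  by rewrite /support_bits tE filter_map -map_comp map_id.
rewrite /mobius count_filter -sum1_count natr_sum big_mkcondr /=.
rewrite -(big_bits _ 8 (fun s => le_bits s (bits S))).
apply: eq_big => T; first by rewrite subset_bits.
by rewrite mem_support_of orbit_indexE code_vec; case: ifP.
Qed.

Lemma degree_invariant_poly a : degree (invariant_poly a) = degree_bits (bits a).
Proof.
pose L := support_bits (bits a); pose P s := odd (count (le_bits^~ s) L).
rewrite /degree msize_anf.
transitivity (\max_(T : {set 'I_8} | P (bits T)) count id (bits T))%N.
  apply: eq_big => T; first exact: mobius_bits.
  by move=> _; rewrite count_map enumT cardE size_filter.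
rewrite (big_bits _ 8 P (fun s => count id s)).
by rewrite /degree_bits foldrE big_map big_filter.
Qed.

Lemma proper_bits (a : {set 'I_4}) : (a \proper setT) = (false \in bits a).
Proof.
rewrite properT; apply/idP/idP => [|/mapP[i _ ia]]; last first.
  by apply: contraFneq (esym ia) => ->; rewrite inE.
apply: contraR => no; apply/eqP/setP=> i; rewrite inE; apply/negP => /negP ia.
by case/negP: no; apply/mapP; exists i; rewrite ?mem_enum // (negPf ia).
Qed.

Lemma degree_invariant_poly_proper (a : {set 'I_4}) :
  a \proper setT -> degree (invariant_poly a) \in [:: 2; 4; 6].
Proof.
rewrite proper_bits degree_invariant_poly => ina.
have /allP/(_ (bits a)) :
    all (fun b => (false \in b) ==> (degree_bits b \in [:: 2; 4; 6])) (cube 4).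
  by vm_compute.
by rewrite mem_cube size_bits => /(_ isT) /implyP; apply.
Qed.

Lemma invariant_poly_inj : injective invariant_poly.
Proof.
move=> a b e; apply/setP=> i.
have lt_i : (i.+1 < 6)%N by case: i => [[|[|[|[|]]]]].
have := peval_invariant_poly a (orbit_rep i.+1).
rewrite e peval_invariant_poly !mem_support_of orbit_index_rep //=.
rewrite (@set_nth_default _ (bits b) false) ?size_bits //.
rewrite (@set_nth_default _ (bits a) false) ?size_bits // !nth_bits.
by do 2!case: (_ \in _).
Qed.

Lemma invariant_poly_setT : invariant_poly setT = 0.
Proof.
apply: big1 => S _; rewrite /mobius big1 ?scale0r // => T _.
by rewrite /support_of setCT big_set0 inE.
Qed.

(** * Classification *)

(** The sizes of the classes are 1, 12, 54, 108, 54, 27, and only the odd ones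
    survive modulo 2. *)
Lemma sum_orbits (phi : nat -> 'F_2) :
  \sum_(T : {set 'I_8}) phi (orbit_index (vec T)) = phi 0%N + phi 5%N.
Proof.
rewrite (eq_bigr (fun T => phi (index_bits (bits T)))) => [|T _]; last first.
  by rewrite orbit_indexE code_vec.
rewrite (big_bits _ 8 xpredT (fun s => phi (index_bits s))) -(big_map index_bits xpredT).
have p : perm_eq [seq index_bits s | s <- cube 8]
    (flatten [seq nseq p.1 p.2 |
                p <- [:: (1, 0); (12, 1); (54, 2); (108, 3); (54, 4); (27, 5)]%N]).
  by vm_compute.
have sum_nseq n k : \sum_(j <- nseq n k) phi j = phi k *+ odd n.
  elim: n => [|n IH]; first by rewrite big_nil.
  rewrite big_cons IH /=; case: (odd n); last by rewrite addr0.
  by rewrite -mulr2n F2_mulr2n.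
rewrite (perm_big _ p) big_flatten big_map; under eq_bigr do rewrite sum_nseq.
by rewrite !big_cons big_nil /= !add0r addr0.
Qed.

(** Q is determined by its values phi k on the six classes.  The constant term
    of Q is phi 0, and the coefficient of the product of all eight variables is
    the sum of all values, phi 0 + phi 5; both vanish. *)
Lemma invariant_poly_classification Q :
  reduced Q -> Q != 0 -> GS_invariant Q -> (degree Q < 8)%N ->
  exists2 a : {set 'I_4}, a \proper setT & Q = invariant_poly a.
Proof.
move=> redQ nzQ invQ degQ.
have QE : Q = anf (fun T => Q.@[chi T]) by apply: anf_meval => m /redQ[].
pose phi k := peval Q (orbit_rep k).
have Qphi T : Q.@[chi T] = phi (orbit_index (vec T)).
  by rewrite /phi -GS_invariant_orbit_rep // peval_supp vecK.
have coefQ S : Q@_(sqfree_mnm S) = mobius (fun T => Q.@[chi T]) S.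
  by rewrite {1}QE mcoeff_sqfree_poly.
have phi0 : phi 0%N = 0.
  transitivity (Q@_(sqfree_mnm set0)).
    by rewrite coefQ mobius_set0 Qphi vec0 /orbit_index eqxx.
  by apply/memN_msupp_eq0/negP => /redQ[]; rewrite sqfree_mnm0 eqxx.
have phi5 : phi 5%N = 0.
  transitivity (Q@_(sqfree_mnm setT)); last first.
    apply/memN_msupp_eq0/msize_mdeg_ge; rewrite mdeg_sqfree cardsT card_ord.
    by move: degQ; rewrite /degree; case: (msize Q).
  rewrite coefQ /mobius (eq_bigl xpredT) => [|T]; last by rewrite subsetT.
  by under eq_bigr do rewrite Qphi; rewrite sum_orbits phi0 add0r.
pose a := [set i : 'I_4 | phi i.+1 == 0].
have Qa : Q = invariant_poly a.
  rewrite QE; apply: eq_anf => T; rewrite Qphi mem_support_of.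
  have := orbit_index_lt (vec T); case: (orbit_index _) => [|k] // lt_k.
  rewrite /=; case: (ltnP k 4) => [lt4|ge4].
    rewrite (set_nth_default false) ?size_bits // (nth_bits _ (Ordinal lt4)) inE.
    exact: F2_boolE.
  rewrite nth_default ?size_bits //; suff -> : k = 4 by [].
  by apply/eqP; rewrite eqn_leq ge4 andbT.
exists a => //; rewrite properT; apply: contraNneq nzQ => aT.
by rewrite Qa aT invariant_poly_setT.
Qed.

Definition proper_sets := enum [pred a : {set 'I_4} | a \proper setT].

Lemma count_degree (P : pred nat) :
  count (fun Q => P (degree Q)) [seq invariant_poly a | a <- proper_sets]
   = count (fun b => (false \in b) && P (degree_bits b)) (cube 4).
Proof.
rewrite -(seq.permP (perm_bits_cube 4)) !count_map count_filter.
by apply: eq_count => a /=; rewrite inE proper_bits degree_invariant_poly andbC.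
Qed.

Theorem mainTheorem4 :
  exists (s : seq {mpoly 'F_2[8]}) (q : {set 'I_4} -> {mpoly 'F_2[8]}),
    (* s lists, without repetition, the polynomials in question *)
    [/\ uniq s,
        (forall Q : {mpoly 'F_2[8]},
           Q \in s <-> [/\ reduced Q, Q != 0, GS_invariant Q & (degree Q < 8)%N])
      & size s = 15%N] /\
    (* q is a bijection from the proper subsets of the index set onto s *)
    [/\ {in [pred a : {set 'I_4} | a \proper setT] &, injective q},
        (forall Q : {mpoly 'F_2[8]},
           Q \in s <-> exists2 a : {set 'I_4}, a \proper setT & Q = q a)
      & (forall a : {set 'I_4}, a \proper setT ->
           zero_set (q a) = O5 :|: \bigcup_(i in a) O_ i)] /\
    [/\ count (fun Q => degree Q == 2%N) s = 1%N,
        count (fun Q => degree Q == 4%N) s = 6%N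
      & count (fun Q => degree Q == 6%N) s = 8%N].
Proof.
have mem_s Q : Q \in [seq invariant_poly a | a <- proper_sets] <->
    exists2 a : {set 'I_4}, a \proper setT & Q = invariant_poly a.
  split=> [/mapP[a]|[a pa ->]]; first by rewrite mem_enum; exists a.
  by apply/mapP; exists a; rewrite ?mem_enum.
exists [seq invariant_poly a | a <- proper_sets], invariant_poly; split; last split.
- split; first by rewrite map_inj_uniq ?enum_uniq //; apply: invariant_poly_inj.
    move=> Q; rewrite mem_s; split=> [[a pa ->]|[]]; last exact: invariant_poly_classification.
    have degQ := degree_invariant_poly_proper pa.
    split; [exact: invariant_poly_reduced| |exact: invariant_poly_GS|].
      by apply: contraTneq degQ => ->; rewrite /degree msize0.
    by move: degQ; rewrite !inE => /or3P[] /eqP ->.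
  by rewrite -[LHS]count_predT (count_degree predT); vm_compute.
- split=> // [a b _ _|a _]; [exact: invariant_poly_inj|exact: zero_set_invariant_poly].
by split; rewrite (count_degree (pred1 _)); vm_compute.
Qed.
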